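(* Let $N\ge1$ and let $f\in\mathbb{C}^N$ have entries $f_j=|f_j|e^{i\phi_j}$, $j=0,\dots,N-1$, where the magnitudes $|f_j|$ are fixed (deterministic) and the phases $\phi_0,\dots,\phi_{N-1}$ are independent random variables uniformly distributed on $[-\pi,\pi)$. Let $K_1<K_2$ be integers, and define $K_c=(K_1+K_2)/2$ and $B=K_2-K_1$. Let $$\hat f_k=\sum_{j=0}^{N-1}f_je^{-i\frac{2\pi}{N}jk}\quad(k\in\mathbb{Z}),\qquad S_{K_1,K_2}f_m=N^{-1}\sum_{k=K_1}^{K_2}\hat f_k\,e^{i\frac{2\pi}{N}mk}\quad(m=0,\dots,N-1).$$ Then the expected value of the squared magnitude of the partial Fourier sum depends (for given $N$ and $|f|$) only on the bandwidth $B$ (and not on the central frequency $K_c$), and for $m=0,1,\dots,N-1$ it is given by $$\mathbb{E}\left(\left|S_{K_1,K_2}f_m\right|^2\right)=N^{-2}\left(|f|^2*|D^N_{B/2}|^2\right)_m .$$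
   Context: For a nonnegative integer or half-integer $n$, the Dirichlet kernel is $D_n(x)=\sum_{k\in\{-n,-n+1,\dots,n\}}e^{ikx}=\frac{\sin((n+1/2)x)}{\sin(x/2)}$ (extended by continuity at $x\in2\pi\mathbb{Z}$). Its discretization is $D_{B/2}^N(m)=D_{B/2}(2\pi m/N)$ for $m\in\mathbb{Z}$. Here $|f|^2$ denotes the vector $(|f_j|^2)_{j=0}^{N-1}$ and $*$ is the discrete convolution $\left(|f|^2*|D_{B/2}^N|^2\right)_m=\sum_{j=0}^{N-1}|f_j|^2\,\bigl|D_{B/2}^N(m-j)\bigr|^2$. *)

(* Defs.v *)
From HB Require Import structures.
From mathcomp Require Import all_boot all_order all_algebra.
From mathcomp Require Import all_classical all_reals all_analysis.
From mathcomp Require Import complex.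

Set Implicit Arguments.
Unset Strict Implicit.
Unset Printing Implicit Defensive.

Import Order.TTheory GRing.Theory Num.Theory.
Import numFieldNormedType.Exports.

Local Open Scope classical_set_scope.
Local Open Scope ring_scope.
Local Open Scope complex_scope.

Section fourier.
Context {R : realType}.

Definition expi (x : R) : R[i] := cos x +i* sin x.

Definition cabs (z : R[i]) : R := Normc.normc z.

(* The Dirichlet kernel D_n of order n = b/2, n being an integer or a
   half-integer; the index k of the sum over {-n, -n+1, ..., n} is l - b/2. *)
Definition dirichlet (b : nat) (x : R) : R[i] :=
  \sum_(l < b.+1) expi ((l%:R - b%:R / 2) * x).

Definition discrete_dirichlet (N b : nat) (m : int) : R[i] :=
  dirichlet b (2 * pi * m%:~R / N%:R).

Definition discrete_convolution (N : nat) (u : 'I_N -> R) (v : int -> R)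
    (m : 'I_N) : R :=
  \sum_(j < N) u j * v (m%:Z - j%:Z).

Definition dft (N : nat) (f : 'rV[R[i]]_N) (k : int) : R[i] :=
  \sum_(j < N) f 0 j * expi (- (2 * pi / N%:R * j%:R * k%:~R)).

(* The frequencies k = K1, ..., K2 are listed as K1 + l with 0 <= l <= K2 - K1;
   this presupposes K1 <= K2. *)
Definition partial_fourier_sum (N : nat) (K1 K2 : int) (f : 'rV[R[i]]_N)
    (m : 'I_N) : R[i] :=
  N%:R^-1 * \sum_(l < `|K2 - K1|%N.+1)
    dft f (K1 + l%:Z) * expi (2 * pi / N%:R * m%:R * (K1 + l%:Z)%:~R).

Lemma ltNpipi : - pi < pi :> R.
Proof. by rewrite gtrN// pi_gt0. Qed.

End fourier.

Section random_phases.
Context {R : realType} {d : measure_display} {T : measurableType d}.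
Variable P : probability T R.

Definition mutually_independent (I : finType) (X : I -> {RV P >-> R}) : Prop :=
  forall (J : {set I}) (A : I -> set R),
    (forall j, measurable (A j)) ->
    P (\bigcap_(j in [set` J]) (X j @^-1` A j)) =
    (\prod_(j in J) P (X j @^-1` A j))%E.

(* uniform_prob is built on the closed interval; as a measure it is also the
   uniform law on [-pi, pi[.  Laws are compared on measurable sets only, since
   the values of a measure on other sets are meaningless. *)
Definition uniform_phase (X : {RV P >-> R}) : Prop :=
  forall A : set R, measurable A ->
    distribution P X A = uniform_prob (@ltNpipi R) A.

Definition independent_uniform_phases (I : finType) (phi : I -> {RV P >-> R}) :
    Prop :=
  mutually_independent phi /\ forall j, uniform_phase (phi j).

(* f_j = |f_j| e^{i phi_j} with mag j = |f_j| *)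
Definition random_phase_signal (N : nat) (mag : 'I_N -> R)
    (phi : 'I_N -> {RV P >-> R}) (w : T) : 'rV[R[i]]_N :=
  \row_(j < N) ((mag j)%:C * expi (phi j w)).

Definition expected_sqr_partial_sum (N : nat) (mag : 'I_N -> R)
    (phi : 'I_N -> {RV P >-> R}) (K1 K2 : int) (m : 'I_N) : \bar R :=
  'E_P[fun w =>
    cabs (partial_fourier_sum K1 K2 (random_phase_signal mag phi w) m) ^+ 2].

End random_phases.

(* Main.v *)
(* The partial sum is [\sum_j a_j e^{i phi_j}] for deterministic [a_j], so its
   squared modulus is the sum over j, k of
   [Re (a_j conj(a_k) e^{i (phi_j - phi_k)})].  For j <> k the joint law of
   (phi_j, phi_k) is the product of the marginals, and integrating first in the
   uniform phi_j gives 0; the diagonal contributes [\sum_j |a_j|^2].  Finally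
   [a_j] is [f_j / N] times a geometric sum over K1, ..., K2, which up to the
   unimodular factor [e^{i K_c theta}] is [D_{B/2} theta] with
   [theta = 2 pi (m - j) / N]. *)
Require Import Defs.
From HB Require Import structures.
From mathcomp Require Import all_boot all_order all_algebra.
From mathcomp Require Import all_classical all_reals all_analysis.
From mathcomp Require Import measurable_realfun complex.
From mathcomp Require Import ring lra.

Set Implicit Arguments.
Unset Strict Implicit.
Unset Printing Implicit Defensive.

Import Order.TTheory GRing.Theory Num.Theory.
Import numFieldNormedType.Exports.

Local Open Scope ring_scope.

Local Notation Re := complex.Re.
Local Notation Im := complex.Im.

(** * Bounded functions under a probability measure *)

Section bounded_integrable.
Context {R : realType}.

Lemma bounded_integrable
    d (T : measurableType d) (P : probability T R) (f : T -> R) (c : R) :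
  measurable_fun setT f -> (forall x, `|f x| <= c) ->
  P.-integrable setT (EFin \o f).
Proof.
move=> mf bf; apply: measurable_bounded_integrable => //.
  by rewrite ltey_eq fin_num_measure.
exists c; split; first exact: num_real.
by move=> y /ltW cy x _ /=; exact: le_trans (bf x) cy.
Qed.

Lemma integral_bounded_addr
    d (T : measurableType d) (P : probability T R) (f : T -> R) (c k : R) :
  measurable_fun setT f -> (forall x, `|f x| <= c) ->
  (\int[P]_x (f x + k)%:E = \int[P]_x (f x)%:E + k%:E)%E.
Proof.
move=> mf bf; under eq_integral do rewrite EFinD.
rewrite integralD//=.
- rewrite integral_cst//.
  by rewrite [X in (_ * X)%E](@probability_setT _ _ _ P) mule1.
- exact: bounded_integrable bf.
- by apply: (@bounded_integrable _ _ P (cst k) `|k|).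
Qed.

End bounded_integrable.

(** * Algebra of [expi] and its mean over a full period *)

Section complex_exponential.
Context {R : realType}.
Implicit Types (x y : R) (z u : R[i]).

Lemma expiD x y : expi (x + y) = expi x * expi y :> R[i].
Proof.
rewrite /expi cosD sinD; apply/eqP; rewrite eq_complex /= eqxx /=.
by apply/eqP; ring.
Qed.

Lemma conjc_expi x : conjc (expi x) = expi (- x) :> R[i].
Proof. by rewrite /expi cosN sinN. Qed.

Lemma cabs_expi x : cabs (expi x) = 1.
Proof. by rewrite /cabs /expi /= cos2Dsin2 sqrtr1. Qed.

Lemma cabsM z u : cabs (z * u) = cabs z * cabs u.
Proof. exact: Normc.normcM. Qed.

Lemma cabs_real x : 0 <= x -> cabs (real_complex R x) = x.
Proof. by move=> x0; rewrite /cabs /= expr0n /= addr0 sqrtr_sqr ger0_norm. Qed.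

Lemma cabs_natV n : cabs (n%:R^-1 : R[i]) = n%:R^-1.
Proof.
rewrite /cabs Normc.normcV -(rmorph_nat (real_complex R)).
by rewrite -[Normc.normc _]/(cabs _) cabs_real.
Qed.

Lemma cabs_ge_Re z : `|Re z| <= cabs z.
Proof. by have := normc_ge_Re z; rewrite normc_def lecR; case: z. Qed.

Lemma sqr_cabs z : cabs z ^+ 2 = Re (z * conjc z).
Proof.
case: z => a b; rewrite /cabs /= sqr_sqrtr ?addr_ge0 ?sqr_ge0//.
by ring.
Qed.

Lemma Re_sum (I : finType) (F : I -> R[i]) :
  Re (\sum_i F i) = \sum_i Re (F i).
Proof. by apply: (big_morph (@Re R)) => // -[a b] [c d]. Qed.

(** Expanding [z * conjc z] leaves a real double sum in which the phases occur only through their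
    differences, ready for termwise real integration. *)
Lemma sqr_cabs_sum (I : finType) (a : I -> R[i]) (t : I -> R) :
  cabs (\sum_j a j * expi (t j)) ^+ 2 =
  \sum_j \sum_k Re (a j * conjc (a k) * expi (t j - t k)).
Proof.
rewrite sqr_cabs rmorph_sum mulr_suml Re_sum; apply: eq_bigr => j _.
rewrite mulr_sumr Re_sum; apply: eq_bigr => k _.
by rewrite expiD -conjc_expi rmorphM mulrACA.
Qed.

Lemma Re_mul_expi z x : Re (z * expi x) = Re z * cos x - Im z * sin x.
Proof. by case: z. Qed.

Lemma continuous_Re_expi z : continuous (fun x => Re (z * expi x)).
Proof.
rewrite (_ : (fun x => _) = (fun x => Re z * cos x - Im z * sin x)); last first.
  by apply/funext => x; rewrite Re_mul_expi.
move=> x; apply: cvgB; apply: cvgM; try exact: cvg_cst.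
  exact: continuous_cos.
exact: continuous_sin.
Qed.

Lemma measurable_Re_expi z : measurable_fun setT (fun x => Re (z * expi x)).
Proof. by apply: continuous_measurable_fun; exact: continuous_Re_expi. Qed.

Lemma Re_mul_expi_le z x : `|Re (z * expi x)| <= cabs z.
Proof. by rewrite -[leRHS]mulr1 -(cabs_expi x) -cabsM cabs_ge_Re. Qed.

Lemma integral_uniform_Re_expi z :
  (\int[uniform_prob (@ltNpipi R)]_x (Re (z * expi x))%:E = 0)%E.
Proof.
pose c := cabs z.
have mf := measurable_Re_expi z.
have bf : forall x, `|Re (z * expi x)| <= c := Re_mul_expi_le z.
pose U : probability _ R := uniform_prob (@ltNpipi R).
(* [integral_uniform] is only stated for nonnegative functions, hence the
   shift by [c]. *)
suff shifted :
    (\int[uniform_prob (@ltNpipi R)]_x (Re (z * expi x) + c)%:E = c%:E)%E.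
  move: shifted; have /= -> := integral_bounded_addr U c mf bf.
  (* The integral is finite, so [c] may be cancelled in the extended reals. *)
  have /integrable_fin_num/fineK <- := bounded_integrable U mf bf.
    by rewrite -EFinD => -[eqc]; congr EFin; lra.
  exact: measurableT.
rewrite integral_uniform//=; first last.
- by move=> x; rewrite lee_fin; have := bf x; rewrite ler_norml; lra.
- by apply/measurable_EFinP; apply: measurable_funD.
(* [F] is a primitive of the shifted integrand. Its trigonometric part takes equal values at [- pi]
   and [pi], so the increment is [2 * pi * c], which the density [1 / (2 * pi)] turns into [c]. *)
pose F x := Re z * sin x + Im z * cos x + c * x.
have dF x : is_derive x 1 F (Re (z * expi x) + c).
  by apply: is_derive_eq; rewrite Re_mul_expi /GRing.scale /=; ring.
have cF : continuous F.
  by move=> x; apply/differentiable_continuous/derivable1_diffP.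
rewrite (@continuous_FTC2 _ _ F) ?ltNpipi//.
- rewrite /F !cosN !sinN cospi sinpi -EFinB -EFinM; congr EFin.
  by field; apply: lt0r_neq0; have := pi_gt0 R; lra.
- apply: continuous_subspaceT => x; apply: cvgD; last exact: cvg_cst.
  exact: continuous_Re_expi.
- split.
  + by move=> x _.
  + by apply: cvg_at_right_filter; exact: cF.
  + by apply: cvg_at_left_filter; exact: cF.
- by move=> x _; rewrite derive1E derive_val.
Qed.

End complex_exponential.

(** * Fubini for two independent variables *)

Section independent_pair.
Context {R : realType} {d : measure_display} {T : measurableType d}.
Variable P : probability T R.

(** Factorization on measurable rectangles identifies the joint law with the product of the
    marginals. The order of integration lets the first variable be averaged with the second one
    fixed. *)
Lemma integral_independent_pair (X Y : {RV P >-> R}) (f : R * R -> R) (c : R) :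
  (forall A B, measurable A -> measurable B ->
    P (X @^-1` A `&` Y @^-1` B)%classic =
    P (X @^-1` A)%classic * P (Y @^-1` B)%classic)%E ->
  measurable_fun setT f -> (forall xy, `|f xy| <= c) ->
  (\int[P]_w (f (X w, Y w))%:E =
   \int[distribution P Y]_y \int[distribution P X]_x (f (x, y))%:E)%E.
Proof.
move=> XY mf bf.
have mXY : measurable_fun setT (fun w => (X w, Y w)).
  exact: measurable_fun_pair.
have mEf : measurable_fun setT (EFin \o f) by exact/measurable_EFinP.
pose XYm : {RV P >-> (R * R)%type} := mfun_Sub (mem_set mXY).
rewrite (integral21_prod_meas1 (f := EFin \o f)); last first.
  exact: bounded_integrable bf.
rewrite (eq_measure_integral (distribution P XYm)); last first.
  by move=> A mA _; apply: product_measure_unique => // B C mB mC; exact: XY.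
rewrite integral_distribution//=.
by apply: (@bounded_integrable _ _ _ _ (fun w => f (X w, Y w)) c) => //;
  exact: measurableT_comp.
Qed.

End independent_pair.

(** * Independent uniform phases *)

Section random_phases.
Context {R : realType} {d : measure_display} {T : measurableType d}.
Variable P : probability T R.

Lemma mutually_independent_pair (I : finType) (X : I -> {RV P >-> R}) j k
    (A B : set R) : mutually_independent X -> j != k ->
  measurable A -> measurable B ->
  (P (X j @^-1` A `&` X k @^-1` B)%classic =
   P (X j @^-1` A)%classic * P (X k @^-1` B)%classic)%E.
Proof.
move=> indX jk mA mB.
have kj : (k == j) = false by rewrite eq_sym (negbTE jk).
(* Only [C j] and [C k] enter the intersection over [[set j; k]]; elsewhere the value [B] just keeps
   the family measurable. *)
pose C i := if i == j then A else B.
have mC i : measurable (C i) by rewrite /C; case: ifP.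
have := indX [set j; k]%SET C mC.
rewrite big_setU1 ?inE// big_set1 /C eqxx kj => <-.
congr (P _); apply/seteqP; split => [w [Aw Bw] i /=|w ABw].
  by rewrite !inE => /orP[] /eqP ->; rewrite ?eqxx ?kj.
have wj := ABw j; have wk := ABw k.
rewrite /= !inE !eqxx ?orbT kj in wj wk.
by split; [exact: wj|exact: wk].
Qed.

Lemma integral_uniform_phase (X : {RV P >-> R}) (f : R -> R) (c : R) :
  uniform_phase X -> measurable_fun setT f -> (forall x, `|f x| <= c) ->
  (\int[distribution P X]_x (f x)%:E =
   \int[uniform_prob (@ltNpipi R)]_x (f x)%:E)%E.
Proof.
move=> unifX mf bf.
(* [uniform_prob] lives on [measurableTypeR R], which has the same measurable
   sets as [R] but another display. *)
have mX : measurable_fun setT (X : T -> measurableTypeR R).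
  by move=> _ A mA; exact: (measurable_funP X).
pose X' : {RV P >-> measurableTypeR R} :=
  @mfun_Sub _ _ T (measurableTypeR R) X (mem_set mX).
have IfX : P.-integrable setT (EFin \o (f \o X)).
  by apply: (@bounded_integrable _ _ _ _ _ c) => [|w];
    [exact: measurableT_comp|exact: bf].
rewrite integral_distribution//; last exact/measurable_EFinP.
(* Both image measures pull back to the same integral of [f \o X] under [P]. *)
transitivity (\int[distribution P X']_x (f x)%:E)%E.
  by rewrite (integral_distribution (X := X'))//; exact/measurable_EFinP.
by apply: eq_measure_integral => A mA _; exact: unifX.
Qed.

(** For fixed [y], the factor [expi (- y)] is absorbed into [z], and the inner integral over the
    uniform variable is already zero. *)
Lemma integral_Re_expi_sub (X Y : {RV P >-> R}) (z : R[i]) :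
  (forall A B, measurable A -> measurable B ->
    P (X @^-1` A `&` Y @^-1` B)%classic =
    P (X @^-1` A)%classic * P (Y @^-1` B)%classic)%E ->
  uniform_phase X ->
  (\int[P]_w (Re (z * expi (X w - Y w)))%:E = 0)%E.
Proof.
move=> indXY unifX.
rewrite (integral_independent_pair
  (f := fun xy => Re (z * expi (xy.1 - xy.2))) (c := cabs z) indXY) /=.
- apply: integral0_eq => y _.
  rewrite -[RHS](integral_uniform_Re_expi (z * expi (- y))).
  have zy x : Re (z * expi (x - y)) = Re (z * expi (- y) * expi x).
    by rewrite -mulrA -expiD [- y + x]addrC.
  under eq_integral do rewrite zy.
  apply: (@integral_uniform_phase _ (fun x => Re (z * expi (- y) * expi x))
    (cabs (z * expi (- y)))) => //.
    exact: measurable_Re_expi.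
  by move=> x; exact: Re_mul_expi_le.
- apply: (measurableT_comp (f := fun x => Re (z * expi x))).
    exact: measurable_Re_expi.
  by apply: measurable_funB.
- by move=> xy; exact: Re_mul_expi_le.
Qed.

Lemma expectation_sqr_cabs_sum (I : finType) (phi : I -> {RV P >-> R})
    (a : I -> R[i]) : independent_uniform_phases phi ->
  expectation P (fun w => cabs (\sum_j a j * expi (phi j w)) ^+ 2) =
  (\sum_j cabs (a j) ^+ 2)%:E.
Proof.
move=> [indphi unifphi]; rewrite unlock.
pose t j k w := Re (a j * conjc (a k) * expi (phi j w - phi k w)).
(* Integrability of each term allows both finite sums to be pulled out of the integral. *)
have It j k : P.-integrable setT (EFin \o t j k).
  apply: (@bounded_integrable _ _ _ _ _ (cabs (a j * conjc (a k)))).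
    apply: (measurableT_comp
      (f := fun x => Re (a j * conjc (a k) * expi x))).
      exact: measurable_Re_expi.
    by apply: measurable_funB.
  by move=> w; exact: Re_mul_expi_le.
under eq_integral do rewrite sqr_cabs_sum -sumEFin.
rewrite integral_sum//; last first.
  move=> j; under eq_fun do rewrite -sumEFin.
  by apply: integrable_sum => // k _; exact: It.
rewrite -sumEFin; apply: eq_bigr => j _.
under eq_integral do rewrite -sumEFin.
rewrite integral_sum//; last by move=> k; exact: It.
(* Only the diagonal term survives; there the phases cancel and the integrand is the constant
   [cabs (a j) ^+ 2]. *)
rewrite (bigD1 j)//= big1 ?adde0 => [|k kj]; last first.
  apply: integral_Re_expi_sub => // A B mA mB.
  by apply: mutually_independent_pair; rewrite // eq_sym.
under eq_integral do rewrite subrr /expi cos0 sin0 mulr1 -sqr_cabs.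
by rewrite integral_cst// [X in (_ * X)%E](@probability_setT _ _ _ P) mule1.
Qed.

End random_phases.

(** * The partial Fourier sum as a modulated Dirichlet kernel *)

Section partial_sums.
Context {R : realType}.

(** This is the coefficient of [f 0 j] in the partial sum at [m], up to the factor [1 / N]; [b]
    stands for the bandwidth. *)
Definition partial_sum_kernel (N b : nat) (K1 m j : int) : R[i] :=
  \sum_(l < b.+1) expi (- (2 * pi / N%:R * j%:~R * (K1 + l%:Z)%:~R)) *
                  expi (2 * pi / N%:R * m%:~R * (K1 + l%:Z)%:~R).

(* The kernel is [D_{b/2}] modulated at the central frequency [K1 + b/2]. *)
Lemma cabs_partial_sum_kernel N b K1 m j :
  cabs (partial_sum_kernel N b K1 m j) = cabs (discrete_dirichlet N b (m - j)).
Proof.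
rewrite /discrete_dirichlet /dirichlet.
set t := 2 * pi * _ / _.
(* A unimodular factor is inserted to recentre the frequencies: [K1 + l] is [K1 + b / 2] plus
   [l - b / 2]. *)
rewrite -[RHS]mul1r -[X in _ = X * _](cabs_expi ((K1%:~R + b%:R / 2) * t)).
rewrite -cabsM mulr_sumr; congr cabs; apply: eq_bigr => l _.
rewrite -!expiD /t; congr expi.
by rewrite !rmorphD /= rmorphN /= -pmulrn; ring.
Qed.

Lemma partial_fourier_sumE (N : nat) (K1 K2 : int) (f : 'rV[R[i]]_N) m :
  partial_fourier_sum K1 K2 f m =
  \sum_j N%:R^-1 * (f 0 j * partial_sum_kernel N `|K2 - K1| K1 m j).
Proof.
rewrite /partial_fourier_sum /dft -mulr_sumr; congr (_ * _).
under eq_bigr do rewrite mulr_suml.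
rewrite exchange_big; apply: eq_bigr => j _ /=; rewrite mulr_sumr.
by apply: eq_bigr => l _; rewrite mulrA.
Qed.

End partial_sums.

(** The frequencies enter the right-hand side only through [K2 - K1], so this formula gives both
    claims of the theorem. *)
Lemma expected_sqr_partial_sumE {R : realType} {d : measure_display}
    {T : measurableType d} (P : probability T R) (N : nat) (mag : 'I_N -> R)
    (phi : 'I_N -> {RV P >-> R}) (K1 K2 : int) (m : 'I_N) :
  (forall j, 0 <= mag j) -> independent_uniform_phases phi ->
  expected_sqr_partial_sum mag phi K1 K2 m =
  (N%:R ^- 2 *
    discrete_convolution (fun j => mag j ^+ 2)
      (fun l => cabs (discrete_dirichlet N `|K2 - K1|%N l) ^+ 2) m)%:E.
Proof.
move=> mag0 indphi; rewrite /expected_sqr_partial_sum.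
(* The deterministic coefficient left once the random phase is split off from the [j]-th entry. *)
pose a (j : 'I_N) := N%:R^-1 *
  (real_complex R (mag j) * partial_sum_kernel N `|K2 - K1| K1 m j).
have -> : (fun w => cabs (partial_fourier_sum K1 K2
      (random_phase_signal mag phi w) m) ^+ 2) =
    (fun w => cabs (\sum_j a j * expi (phi j w)) ^+ 2).
  apply/funext => w; rewrite partial_fourier_sumE; congr (cabs _ ^+ 2).
  by apply: eq_bigr => j _; rewrite mxE /a -!mulrA [expi _ * _]mulrC.
rewrite expectation_sqr_cabs_sum//; congr EFin.
rewrite /discrete_convolution mulr_sumr; apply: eq_bigr => j _.
rewrite /a !cabsM cabs_natV cabs_real// cabs_partial_sum_kernel.
by rewrite !exprMn exprVn.
Qed.

Theorem theorem2 (R : realType) (N : nat) (hN : (1 <= N)%N)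
    (mag : 'I_N -> R) (mag_ge0 : forall j, 0 <= mag j)
    (d : measure_display) (T : measurableType d) (P : probability T R)
    (phi : 'I_N -> {RV P >-> R}) (hphi : independent_uniform_phases phi)
    (K1 K2 : int) (hK : K1 < K2) :
  (forall (d' : measure_display) (T' : measurableType d')
      (P' : probability T' R) (phi' : 'I_N -> {RV P' >-> R}) (K1' K2' : int),
    independent_uniform_phases phi' -> K1' < K2' -> K2' - K1' = K2 - K1 ->
    forall m : 'I_N,
      expected_sqr_partial_sum mag phi' K1' K2' m =
      expected_sqr_partial_sum mag phi K1 K2 m)
  /\
  forall m : 'I_N,
    expected_sqr_partial_sum mag phi K1 K2 m =
    (N%:R ^- 2 *
      discrete_convolution (fun j => mag j ^+ 2)
        (fun l => cabs (discrete_dirichlet N `|K2 - K1|%N l) ^+ 2) m)%:E.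
Proof.
split=> [d' T' P' phi' K1' K2' hphi' hK' eqB m|m].
  (* Both expectations become the same convolution once the bandwidths are identified. *)
  by rewrite !expected_sqr_partial_sumE// eqB.
exact: expected_sqr_partial_sumE.
Qed.
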